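(* There exists an absolute constant $C>0$ such that for every sequence $\omega\in\{0,1,2\}^{\mathbb N}$ that is not eventually constant, the Følner function of the Grigorchuk group $G_\omega$ with respect to its standard generating set $S=\{a,b_\omega,c_\omega,d_\omega\}$ satisfies $$\mathrm{F\o l}_{G_\omega,S}(n)\ge 2^{Cn}\qquad\text{for all integers } n\ge 2.$$
   Context: Følner function: for a group $G$ with finite symmetric generating set $S$ and word metric $d_S$, $\partial_S V$ is the set of $v\in V$ at $d_S$-distance one from $G\setminus V$, and $\mathrm{F\o l}_{G,S}(n)$ is the minimum of $\#V$ over finite non-empty $V\subset G$ with $\#\partial_SV/\#V\le 1/n$ ($+\infty$ if there is none). Grigorchuk groups: let $\mathsf T$ be the rooted binary tree. An automorphism fixing both vertices of the first level is written $(g_1,g_2)$, where $g_1,g_2\in \mathrm{Aut}(\mathsf T)$ are its actions on the two subtrees of the root (each identified with $\mathsf T$). The automorphism $a$ swaps the two subtrees of the root. For $\omega=\omega_1\omega_2\omega_3\ldots\in\{0,1,2\}^{\mathbb N}$ let $\mathfrak s\omega=\omega_2\omega_3\ldots$ be the shifted sequence, and define recursively $b_\omega=(\phi_{\omega_1}(b),b_{\mathfrak s\omega})$, $c_\omega=(\phi_{\omega_1}(c),c_{\mathfrak s\omega})$, $d_\omega=(\phi_{\omega_1}(d),d_{\mathfrak s\omega})$, where $\phi_0(b)=a,\phi_0(c)=a,\phi_0(d)=1$; $\phi_1(b)=a,\phi_1(c)=1,\phi_1(d)=a$; $\phi_2(b)=1,\phi_2(c)=a,\phi_2(d)=a$.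 Then $G_\omega=\langle a,b_\omega,c_\omega,d_\omega\rangle\subset\mathrm{Aut}(\mathsf T)$; the generators are involutions. *)

(* Defs.v *)
From HB Require Import structures.
From mathcomp Require Import all_boot all_order all_algebra.
From mathcomp Require Import finmap.
From mathcomp Require Import all_classical all_reals all_analysis.

Set Implicit Arguments.
Unset Strict Implicit.
Unset Printing Implicit Defensive.

Import Order.TTheory GRing.Theory Num.Theory.

(** * Word metric and Folner function *)

Section Folner.
Local Open Scope classical_set_scope.
Local Open Scope ring_scope.
Local Open Scope ereal_scope.
Context (R : realType) (G : groupType) (S : {fset G}).

(* Left-invariant word metric, with value +oo if g^-1 h is not a product of
   elements of S. No inverses of letters are used: S is meant to be symmetric. *)
Definition word_dist (g h : G) : \bar R :=
  ereal_inf [set (size w)%:R%:E | w in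
    [set w : seq G | all (mem S) w /\ (\prod_(x <- w) x = g^-1 * h)%g]].

Definition word_dist_set (g : G) (A : set G) : \bar R :=
  ereal_inf [set word_dist g h | h in A].

Definition boundary (V : {fset G}) : {fset G} :=
  [fset v in V | `[< word_dist_set v (~` [set` V]) = 1 >]]%fset.

(* An infimum of natural numbers: it is attained if some V qualifies, and is
   +oo otherwise. *)
Definition folner (n : nat) : \bar R :=
  ereal_inf [set (#|` V|)%:R%:E | V in
    [set V : {fset G} | V != fset0 /\
       ((#|` boundary V|)%:R / (#|` V|)%:R <= n%:R^-1 :> R)%R]].

End Folner.

(** * Subgroup generated by a finite set *)

Section Generated.
Local Open Scope group_scope.
Context (G : groupType) (A : {fset G}).

Definition gen_pred : {pred G} :=
  fun x => `[< forall H : {pred G}, group_closed H ->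
                 {subset A <= H} -> x \in H >].

Record generated := Generated { gen_val : G; _ : gen_val \in gen_pred }.

HB.instance Definition _ := [isSub for gen_val].
HB.instance Definition _ := [Choice of generated by <:].

Lemma gen_group_closed : group_closed gen_pred.
Proof.
split; first by apply/asboolP => H [].
move=> x y /asboolP xA /asboolP yA; apply/asboolP => H gH AH.
by case: (gH) => _; apply; [exact: xA | exact: yA].
Qed.

HB.instance Definition _ :=
  SubChoice_isSubGroup.Build G gen_pred generated gen_group_closed.

Lemma mem_gen x : x \in A -> x \in gen_pred.
Proof. by move=> xA; apply/asboolP => H _; apply. Qed.

Definition gen_elt x (xA : x \in A) : generated := Generated (mem_gen xA).

End Generated.

(** * Automorphisms of the rooted binary tree *)

(* A vertex is the path that leads to it from the root [::]; the first letter
   tells in which of the two subtrees of the root it lies (false: first,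
   true: second), and the rest is its name in that subtree. *)
Notation vertex := (seq bool).

Definition edge (u v : vertex) : bool :=
  [exists x : bool, (v == rcons u x) || (u == rcons v x)].

Definition tree_aut (f : vertex -> vertex) : Prop :=
  [/\ bijective f, f [::] = [::] & forall u v, edge (f u) (f v) = edge u v].

Record autT := AutT { autT_fun :> vertex -> vertex;
                      _ : `[< tree_aut autT_fun >] }.

HB.instance Definition _ := [isSub for autT_fun].
HB.instance Definition _ := [Choice of autT by <:].

Lemma autTP (g : autT) : tree_aut g.
Proof. exact/asboolP/(valP g). Qed.

Definition mk_autT f (fP : tree_aut f) : autT := AutT (introT (asboolP _) fP).

Lemma autT_eq (g h : autT) : g =1 h -> g = h.
Proof. by move=> gh; apply/val_inj/funext. Qed.

Lemma tree_aut_id : tree_aut id.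
Proof. by split=> //; exists id. Qed.

Lemma tree_aut_comp f g : tree_aut f -> tree_aut g -> tree_aut (f \o g).
Proof.
case=> bf f0 ef [bg g0 eg]; split=> [||u v /=].
- exact: bij_comp.
- by rewrite /= g0.
- by rewrite ef eg.
Qed.

Lemma tree_aut_inv f : tree_aut f ->
  {g | [/\ tree_aut g, cancel f g & cancel g f]}.
Proof.
case=> bf f0 ef; apply: cid; case: bf => g fK gK; exists g; split=> //; split.
- by exists f.
- by rewrite -f0 fK.
- by move=> u v; rewrite -ef !gK.
Qed.

Definition autT_one : autT := mk_autT tree_aut_id.
Definition autT_mul (g h : autT) : autT :=
  mk_autT (tree_aut_comp (autTP g) (autTP h)).
Definition autT_inv (g : autT) : autT :=
  mk_autT (let: And3 gP _ _ := svalP (tree_aut_inv (autTP g)) in gP).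

Lemma autT_mulA : associative autT_mul.
Proof. by move=> f g h; apply: autT_eq. Qed.
Lemma autT_mul1g : left_id autT_one autT_mul.
Proof. by move=> g; apply: autT_eq. Qed.
Lemma autT_mulg1 : right_id autT_one autT_mul.
Proof. by move=> g; apply: autT_eq. Qed.
Lemma autT_mulVg : left_inverse autT_one autT_inv autT_mul.
Proof.
move=> g; apply: autT_eq => v.
by have [_ gK _] := svalP (tree_aut_inv (autTP g)); exact: gK.
Qed.
Lemma autT_mulgV : right_inverse autT_one autT_inv autT_mul.
Proof.
move=> g; apply: autT_eq => v.
by have [_ _ gK] := svalP (tree_aut_inv (autTP g)); exact: gK.
Qed.

(* The product is composition of maps: (g * h) v = g (h v). *)
HB.instance Definition _ := isGroup.Build autT
  autT_mulA autT_mul1g autT_mulg1 autT_mulVg autT_mulgV.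

Lemma edge_sym u v : edge u v = edge v u.
Proof. by apply: eq_existsb => x; rewrite orbC. Qed.

Lemma edge_nil u : edge [::] u = (size u == 1).
Proof.
apply/existsP/idP => [[x /orP[/eqP->//|]]|]; first by case: u.
by case: u => [|x []] // _; exists x; rewrite eqxx.
Qed.

Lemma edge_cons x y u v : edge (x :: u) (y :: v) = (x == y) && edge u v.
Proof.
rewrite /edge; case: (eqVneq x y) => [<-|nxy] /=.
  by apply: eq_existsb => z; rewrite !eqseq_cons eqxx.
apply/existsP => -[z]; rewrite !eqseq_cons.
by rewrite (negPf nxy) eq_sym (negPf nxy).
Qed.

Lemma tree_aut_branch (s : bool -> bool) (f : bool -> vertex -> vertex) g :
    bijective s -> (forall x, tree_aut (f x)) ->
    g [::] = [::] -> (forall x v, g (x :: v) = s x :: f x v) ->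
  tree_aut g.
Proof.
case=> t sK tK fP g0 gE.
have size_f x v : (size (f x v) == 0) = (size v == 0).
  have [/bij_inj injf f0 _] := fP x.
  by rewrite !size_eq0 -{1}f0 (inj_eq injf).
split=> //.
- have h x := tree_aut_inv (fP x).
  exists (fun v => if v is x :: w then t x :: sval (h (t x)) w else [::]).
    case=> [|x v]; rewrite ?g0 // gE sK; congr cons.
    by have [_ fK _] := svalP (h x); exact: fK.
  case=> [|x v]; rewrite ?g0 // gE tK; congr cons.
  by have [_ _ fK] := svalP (h (t x)); exact: fK.
- case=> [|x u] [|y v]; rewrite ?g0 ?gE //.
  + by rewrite !edge_nil /= !eqSS size_f.
  + by rewrite ![edge _ [::]]edge_sym !edge_nil /= !eqSS size_f.
  + rewrite !edge_cons (can_eq sK); case: eqP => //= <-.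
    by have [_ _ ->] := fP x.
Qed.

(* pair g1 g2 is the automorphism (g1, g2), and swapT is a. *)
Definition pair_fun (g1 g2 : autT) (v : vertex) : vertex :=
  if v is x :: w then x :: (if x then g2 w else g1 w) else [::].

Lemma pair_aut g1 g2 : tree_aut (pair_fun g1 g2).
Proof.
apply: (@tree_aut_branch id (fun x => if x then g2 else g1)) => //.
- by exists id.
- by case; exact: autTP.
- by move=> [].
Qed.

Definition pair g1 g2 : autT := mk_autT (pair_aut g1 g2).

Definition swap_fun (v : vertex) : vertex :=
  if v is x :: w then ~~ x :: w else [::].

Lemma swap_aut : tree_aut swap_fun.
Proof.
apply: (@tree_aut_branch negb (fun=> id)) => //.
- by exists negb; exact: negbK.
- by move=> _; exact: tree_aut_id.
Qed.

Definition swapT : autT := mk_autT swap_aut.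

(** * Grigorchuk groups *)

(* The sequence omega_1 omega_2 ... is indexed from 0: omega_(i+1) = omega i. *)
Definition shift (omega : nat -> 'I_3) : nat -> 'I_3 := fun i => omega i.+1.

Definition eventually_constant (omega : nat -> 'I_3) : Prop :=
  exists N k, forall i, N <= i -> omega i = k.

Inductive letter := letter_b | letter_c | letter_d.

Definition phi (i : 'I_3) (x : letter) : autT :=
  match x with
  | letter_b => if i == 2 :> nat then 1%g else swapT
  | letter_c => if i == 1 :> nat then 1%g else swapT
  | letter_d => if i == 0 :> nat then 1%g else swapT
  end.

(* x_omega = (phi_(omega_1)(x), x_(shift omega)) for x = b, c, d, computed
   vertex by vertex; see lettE below. *)
Fixpoint lett_fun (x : letter) (omega : nat -> 'I_3) (v : vertex) : vertex :=
  match v with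
  | [::] => [::]
  | false :: w => false :: phi (omega 0) x w
  | true :: w => true :: lett_fun x (shift omega) w
  end.

Lemma lett_fun_cons x omega y w : lett_fun x omega (y :: w) =
  y :: (if y then lett_fun x (shift omega) w else phi (omega 0) x w).
Proof. by case: y. Qed.

Lemma phiK i x : involutive (phi i x).
Proof.
have swapK : involutive swapT by case=> // y w /=; rewrite negbK.
by case: x; rewrite /phi; case: ifP => _ //; exact: swapK.
Qed.

Lemma lett_funK x omega : involutive (lett_fun x omega).
Proof.
move=> v; elim: v omega => [//|[] v IHv] omega /=; first by rewrite IHv.
by rewrite phiK.
Qed.

Lemma lett_aut x omega : tree_aut (lett_fun x omega).
Proof.
split=> //; first by exists (lett_fun x omega); exact: lett_funK.
have size_nil (f : vertex -> vertex) : injective f -> f [::] = [::] ->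
    forall v, (size (f v) == 0) = (size v == 0).
  by move=> injf f0 v; rewrite !size_eq0 -{1}f0 (inj_eq injf).
have size_l o := size_nil _ (can_inj (lett_funK x o)) erefl.
have size_p i : forall v, (size (phi i x v) == 0) = (size v == 0).
  by case: (autTP (phi i x)) => /bij_inj injf f0 _; exact: size_nil.
move=> u v; elim: u v omega => [|y u IHu] [|z v] omega //.
- by rewrite !edge_nil; case: z; rewrite /= eqSS ?size_l ?size_p.
- rewrite ![edge _ [::]]edge_sym !edge_nil.
  by case: y; rewrite /= eqSS ?size_l ?size_p.
- rewrite !lett_fun_cons !edge_cons; case: eqP => //= <-.
  by case: y; [exact: IHu | case: (autTP (phi (omega 0) x))].
Qed.

Definition lett x omega : autT := mk_autT (lett_aut x omega).

Lemma lettE x omega :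
  lett x omega = pair (phi (omega 0) x) (lett x (shift omega)).
Proof. by apply: autT_eq => -[|[] v]. Qed.

Definition grig_gens omega : {fset autT} :=
  [fset swapT; lett letter_b omega; lett letter_c omega;
        lett letter_d omega]%fset.

Definition grigorchuk omega : groupType := generated (grig_gens omega).

Lemma swap_in omega : swapT \in grig_gens omega.
Proof. by rewrite !inE eqxx. Qed.
Lemma lett_in x omega : lett x omega \in grig_gens omega.
Proof. by case: x; rewrite !inE eqxx ?orbT. Qed.

Definition grig_a omega : grigorchuk omega := gen_elt (swap_in omega).
Definition grig_b omega : grigorchuk omega := gen_elt (lett_in letter_b omega).
Definition grig_c omega : grigorchuk omega := gen_elt (lett_in letter_c omega).
Definition grig_d omega : grigorchuk omega := gen_elt (lett_in letter_d omega).

Definition grig_S omega : {fset grigorchuk omega} :=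
  [fset grig_a omega; grig_b omega; grig_c omega; grig_d omega]%fset.

(* Main.v *)
Require Import Defs.
From mathcomp Require Import all_boot all_order all_algebra.
From mathcomp Require Import finmap.
From mathcomp Require Import zify.
From mathcomp Require Import all_classical all_reals all_analysis.

(** If a finite set V has relative boundary at most 1/n, then for every word of
    length at most n/2 at least half of the points of V stay in V when
    multiplied by it on the right.  So a lower bound on V follows from having,
    among the elements of length O(n), a family t_1, ..., t_k with k
    proportional to n that behaves like the basis of a cube.  The averaged
    information is that the graph on V with edges g -- g t_i has average degree
    proportional to k; deleting vertices of small degree leaves a nonempty
    subset of minimal degree at least d, with d still proportional to k.  If
    there are functions p_i such that multiplication by t_i changes p_i and no
    p_j with j <> i, then such a subset has at least 2^d points: cut it
    according to the value of a p_i that varies on it, and note that each slice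
    loses at most one from its degrees (mindeg_card, edge_count,
    folner_card_cube).

    In a Grigorchuk group the t_i are elements of the rigid stabilisers of the
    2^m vertices u of level m: t_u acts on the subtree below u as a fixed
    nontrivial element w of the group of the m times shifted sequence, and
    trivially elsewhere.  If w moves y, then p_u(g) = g(uy) has the required
    property.  These t_u are short: the substitution a -> a y a, with y a letter
    such that phi(y) = a, lifts a word in the group of the shifted sequence to a
    word acting in the same way on the second subtree and as an element of a
    dihedral group on the first one.  It doubles the number of letters a, so that
    m substitutions multiply lengths by O(2^m), and t_u has length at most
    28 * 2^m (size_rist).

    The action on the first subtree is trivial for every word that dies as soon
    as one of b, c, d is set to 1 (killed_word), since one of them always maps
    to 1 there; this class is stable under the substitution.  The commutator
    w = [[x^a, y], z^a], where x is the letter with phi(x) = 1 and y, z are the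
    other two, is such a word.  It is nontrivial in the group of every sequence
    that is not eventually constant (base_word_neq1), although this sequence may
    stay constant for arbitrarily long; hence the uniform constant. *)

Set Implicit Arguments.
Unset Strict Implicit.
Unset Printing Implicit Defensive.

Import Order.TTheory GRing.Theory Num.Theory.
Local Open Scope ring_scope.

(** * Subsets of a cube *)

Section Cubes.
Local Open Scope nat_scope.
Local Open Scope fset_scope.
Context (T : choiceType) (X : eqType) (I : finType).
Context (f : I -> T -> T) (p : I -> T -> X).
Hypothesis f_inj : forall i, injective (f i).
Hypothesis pf_neq : forall i u, p i (f i u) != p i u.
Hypothesis pf_eq : forall i j u, j != i -> p j (f i u) = p j u.

(** The points f i u are the neighbours of u in direction i; p i plays the role
    of the i-th coordinate. *)
Definition outdirs (U : {fset T}) u := [set i | f i u \in U].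
Definition indirs (U : {fset T}) u := [set i | has (fun v => f i v == u) U].
Definition dirs U u := outdirs U u :|: indirs U u.

Lemma in_dirs U i u :
  (i \in dirs U u) = (f i u \in U) || has (fun v => f i v == u) U.
Proof. by rewrite !inE. Qed.

Definition slice (U : {fset T}) i y := [fset v in U | p i v == y].

Lemma dirs_slice (U : {fset T}) i u : u \in U ->
  dirs U u :\ i \subset dirs (slice U i (p i u)) u.
Proof.
move=> uU; apply/fintype.subsetP => j; rewrite in_setD1 !in_dirs eq_sym => /andP[ij].
case/orP=> [fuU|/hasP[v vU /eqP fv]]; apply/orP.
  by left; rewrite !inE fuU /= pf_eq.
right; apply/hasP; exists v; last exact/eqP.
by rewrite !inE; apply/andP; split; rewrite // -fv pf_eq.
Qed.

(** Induction on d: some coordinate p i takes two values on U, because some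
    vertex has a neighbour; the two slices are disjoint, and inside a slice only
    the direction i is lost. *)
Lemma mindeg_card d (U : {fset T}) : U != fset0 ->
  {in U, forall u, d <= #|dirs U u|} -> 2 ^ d <= #|` U|.
Proof.
elim: d U => [|d IHd] U U0 dU; first by rewrite expn0 cardfs_gt0.
have slice_card i u : u \in U -> 2 ^ d <= #|` slice U i (p i u)|.
  move=> uU; apply: IHd => [|v].
    by apply/fset0Pn; exists u; rewrite !inE uU /=.
  rewrite !inE => /andP[vU /eqP <-].
  apply: leq_trans (subset_leq_card (dirs_slice i vU)).
  have := dU _ vU; rewrite (cardsD1 i (dirs U v)); case: (i \in _) => //.
  exact: ltnW.
have [i [u [v [uU vU puv]]]] :
    exists i u v, [/\ u \in U, v \in U & p i u != p i v].
  have /fset0Pn[u uU] := U0.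
  have /card_gt0P[i] : 0 < #|dirs U u| by exact: leq_trans (dU _ uU).
  rewrite in_dirs => /orP[fuU|/hasP[v vU /eqP fv]].
    by exists i, (f i u), u; split.
  by exists i, u, v; split=> //; rewrite -fv.
rewrite expnS mul2n -addnn.
apply: leq_trans (leq_add (slice_card i _ uU) (slice_card i _ vU)) _.
rewrite -cardfsUI; set D := _ `&` _.
have -> : D = fset0.
  apply/fsetP => x; rewrite !inE; apply/negP => /andP[/andP[_ /eqP xu]].
  by rewrite xu (negPf puv) andbF.
rewrite cardfs0 addn0; apply: fsubset_leq_card; apply/fsubsetP => x.
by rewrite !inE => /orP[] /andP[].
Qed.

(** Each direction contributes at most one edge into u, by injectivity of f i. *)
Lemma sum_indirs (U : {fset T}) u :
  \sum_(v <- U) #|[set i | f i v == u]| <= #|indirs U u|.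
Proof.
under eq_bigr do rewrite -sum1dep_card big_mkcond.
rewrite exchange_big -sum1_card [leqRHS]big_mkcond; apply: leq_sum => i _ /=.
rewrite inE; case: ifPn => [/hasP[v vU /eqP fv]|/hasPn nU].
  rewrite (big_fsetD1 v) //= fv eqxx big_seq big1 ?addn0 // => w.
  by rewrite !inE -fv (inj_eq (@f_inj i)) => /andP[/negPf->].
by rewrite big_seq big1 // => v /nU /negPf->.
Qed.

(** A set with fewer than 2^d points has no nonempty subset of minimal degree d,
    so its vertices can be deleted one after the other, each being of degree
    less than d at the time of its deletion; a deletion removes at most d
    outgoing and d incoming edges. *)
Lemma edge_count d (V U : {fset T}) : #|` V| < 2 ^ d -> U `<=` V ->
  \sum_(u <- U) #|outdirs U u| <= 2 * d * #|` U|.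
Proof.
move=> Vd; move En: #|` U| => n; elim: n U En => [|n IHn] U En UV.
  by move/cardfs0_eq: En => ->; rewrite big_seq_fset0.
have U0 : U != fset0 by rewrite -cardfs_gt0 En.
have [u uU du] : exists2 u, u \in U & #|dirs U u| < d.
  apply: contrapT => nU; move: Vd; rewrite ltnNge => /negP; apply.
  apply: leq_trans (fsubset_leq_card UV); apply: mindeg_card => // u uU.
  by rewrite leqNgt; apply/negP => du; apply: nU; exists u.
have cardU' : #|` U `\ u| = n by move: En; rewrite (cardfsD1 u) uU => -[].
rewrite (big_fsetD1 u) //=.
have outU v : #|outdirs U v| <= #|outdirs (U `\ u) v| + #|[set i | f i v == u]|.
  apply: leq_trans (leq_card_setU _ _); apply: subset_leq_card.
  apply/fintype.subsetP => i; rewrite !inE /= => fvU; rewrite fvU andbT.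
  by case: eqP.
rewrite mulnS addnC.
apply: leq_trans (_ : (2 * d * n + d) + d <= _); last first.
  by rewrite -addnA addnn -mul2n addnC.
apply: leq_add; last first.
  by apply: leq_trans (ltnW du); apply/subset_leq_card/finset.subsetUl.
apply: leq_trans (leq_sum _ (fun v _ => outU v)) _.
rewrite big_split /= leq_add ?IHn //.
  by apply: fsubset_trans UV; apply: fsubsetDl.
apply: leq_trans (sum_indirs _ _) _; apply: leq_trans (ltnW du).
apply/subset_leq_card/fintype.subsetP => i; rewrite !inE => /hasP[v].
rewrite !inE => /andP[_ vU] fv; apply/orP; right; apply/hasP.
by exists v.
Qed.
End Cubes.

(** * Points that leave a set with small boundary *)

Section Words.
Local Open Scope group_scope.
Context (R : realType) (G : groupType) (S : {fset G}).
Implicit Types (V : {fset G}) (W : seq G).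

Lemma word_dist_ge1 (g h : G) : g != h -> (1 <= word_dist R S g h)%E.
Proof.
move=> gh; apply/ereal_infP => _ [[|x w] [_ wE] <-].
  by move: gh; rewrite -[h](mulVKg g) -wE big_nil mulg1 eqxx.
by rewrite lee_fin ler1n.
Qed.

Lemma in_boundary V v s : v \in V -> s \in S -> v * s \notin V ->
  v \in boundary R S V.
Proof.
move=> vV sS vsV; rewrite /boundary !inE /= vV /=.
apply/asboolP/eqP; rewrite eq_le; apply/andP; split; last first.
  apply/ereal_infP => _ [h hV <-]; apply: word_dist_ge1.
  by apply: contra_not_neq hV => <-.
apply: ge_ereal_inf; exists (word_dist R S v (v * s)).
  by exists (v * s) => //=; apply/negP.
apply: ge_ereal_inf; exists 1%:E => //; exists [:: s] => //=.
by rewrite sS big_seq1 mulKg.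
Qed.

Definition exits V (t : G) := [fset v in V | v * t \notin V]%fset.

(** A path that starts in V and ends outside V passes through a boundary point
    just before it leaves V for the first time, and its starting point is
    determined by that boundary point and the time. *)
Lemma card_exits V W : all (mem S) W ->
  (#|` exits V (\prod_(x <- W) x)| <= size W * #|` boundary R S V|)%N.
Proof.
elim: W => [_|s W IHW /= /andP[sS WS]].
  rewrite big_nil mul0n leqn0 cardfs_eq0; apply/eqP/fsetP => v.
  by rewrite !inE mulg1 andbN.
rewrite big_cons mulSn.
set P := \prod_(x <- W) x in IHW *.
have sub : (exits V (s * P) `<=`
    boundary R S V `|` [fset v * s^-1 | v in exits V P])%fset.
  apply/fsubsetP => v; rewrite in_fsetU 2!inE mulgA => /andP[vV vsP]; apply/orP.
  have [vsV|vsV] := boolP (v * s \in V); last first.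
    by left; exact: (in_boundary vV sS vsV).
  right; apply/imfsetP; exists (v * s); rewrite ?mulgK //=.
  by rewrite !inE vsV.
apply: leq_trans (fsubset_leq_card sub) _.
rewrite cardfsU; apply: leq_trans (leq_subr _ _) _; rewrite leq_add2l.
by rewrite card_imfset ?IHW //; exact: mulIg.
Qed.

(** A one-point set equals its boundary. *)
Lemma folner_card_gt1 V s : s \in S -> s != 1 -> V != fset0 ->
  (2 * #|` boundary R S V| <= #|` V|)%N -> (1 < #|` V|)%N.
Proof.
move=> sS s1 V0 bV; rewrite ltn_neqAle cardfs_gt0 V0 andbT eq_sym.
apply/negP => /cardfs1P[v EV]; move: bV; rewrite {2}EV cardfs1.
apply/negP; rewrite -ltnNge.
suff: (0 < #|` boundary R S V|)%N by exact: (leq_mul (leqnn 2)).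
rewrite cardfs_gt0; apply/fset0Pn; exists v; apply: (in_boundary _ sS).
  by rewrite EV inE.
by rewrite EV inE -[X in _ != X]mulg1 (inj_eq (mulgI v)).
Qed.

Section Independent.
Context (X : eqType) (I : finType) (t : I -> seq G) (p : I -> G -> X).
Hypothesis tS : forall i, all (mem S) (t i).
Let T i := \prod_(x <- t i) x.
Hypothesis p_neq : forall i g, p i (g * T i) != p i g.
Hypothesis p_eq : forall i j g, j != i -> p j (g * T i) = p j g.

(** At most half of the pairs (v, i) leave V, by card_exits; the remaining ones
    are too many for edge_count unless V has at least 2^d points. *)
Lemma folner_card_cube V L d : (forall i, size (t i) <= L)%N ->
  V != fset0 -> (2 * L * #|` boundary R S V| <= #|` V|)%N ->
  (4 * d < #|I|)%N -> (2 ^ d <= #|` V|)%N.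
Proof.
move=> tL V0 bV dI; rewrite leqNgt; apply/negP => Vd.
pose f i g := g * T i.
have f_inj i : injective (f i) by exact: mulIg.
have := edge_count f_inj p_neq p_eq Vd (fsubset_refl V).
apply/negP; rewrite -ltnNge.
have out v : #|outdirs f V v| = (#|I| - #|[set i : I | f i v \notin V]|)%N.
  rewrite cardsCs; congr (_ - #|pred_of_set _|)%N; apply/setP => i.
  by rewrite !finset.inE.
have card_out : (\sum_(v <- V) #|outdirs f V v| +
    \sum_(v <- V) #|[set i : I | f i v \notin V]| = #|I| * #|` V|)%N.
  rewrite -big_split /= -[#|` V|]sum1_size big_distrr /=; apply: eq_bigr => v _.
  by rewrite out subnK ?muln1 // max_card.
have card_exit : (2 * \sum_(v <- V) #|[set i : I | f i v \notin V]| <=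
    #|I| * #|` V|)%N.
  under eq_bigr do rewrite -sum1dep_card big_mkcond.
  rewrite exchange_big big_distrr /= -sum_nat_const; apply: leq_sum => i _.
  apply: leq_trans bV; rewrite -mulnA leq_mul2l /=.
  apply: leq_trans (leq_mul (tL i) (leqnn _)).
  apply: leq_trans (card_exits V (tS i)).
  by rewrite -[#|` _|]sum1_size -big_fset_condE -big_mkcond.
have := V0; rewrite -cardfs_gt0 => V_gt0.
have : (4 * d * #|` V| < #|I| * #|` V|)%N by rewrite ltn_pmul2r.
have -> : (4 * d * #|` V| = 2 * (2 * d * #|` V|))%N by rewrite !mulnA.
move: card_out card_exit; move: (\sum_(v <- V) _) (\sum_(v <- V) _) => e x.
move: (#|I| * _)%N (2 * d * _)%N => k q; lia.
Qed.

End Independent.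
End Words.

(** * Rigid stabilisers in Grigorchuk groups *)

Section Eval.
Local Open Scope group_scope.
Implicit Types (g h : autT) (l : letter) (o : option letter).

Lemma pairM g1 g2 h1 h2 : pair g1 g2 * pair h1 h2 = pair (g1 * h1) (g2 * h2).
Proof. by apply: autT_eq => -[|[] v]. Qed.

Lemma pair11 : pair 1 1 = 1.
Proof. by apply: autT_eq => -[|[] v]. Qed.

Lemma pair_inj g1 g2 h1 h2 : pair g1 g2 = pair h1 h2 -> g1 = h1 /\ g2 = h2.
Proof.
move=> e; split; apply: autT_eq => v.
  by have := congr1 (fun g : autT => g (false :: v)) e => -[].
by have := congr1 (fun g : autT => g (true :: v)) e => -[].
Qed.

Lemma swapT2 : swapT * swapT = 1.
Proof. by apply: autT_eq => -[|[] v]. Qed.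

Lemma swap_pair g1 g2 : swapT * pair g1 g2 * swapT = pair g2 g1.
Proof. by apply: autT_eq => -[|[] v]. Qed.

Lemma swap_neq_pair g1 g2 : swapT <> pair g1 g2.
Proof. by move/(congr1 (fun g : autT => g [:: false])). Qed.

Lemma lett2 l omega : lett l omega * lett l omega = 1.
Proof. by apply: autT_eq => v; exact: lett_funK. Qed.

Lemma phi2 i l : phi i l * phi i l = 1.
Proof. by apply: autT_eq => v; exact: phiK. Qed.

(** The letter sent to 1 by phi i; active i and other i are the two letters sent
    to a. *)
Definition silent (i : 'I_3) : letter :=
  if i == 0 :> nat then letter_d else
  if i == 1%N :> nat then letter_c else letter_b.

Definition active (i : 'I_3) : letter :=
  if i == 2 :> nat then letter_c else letter_b.

Definition other (i : 'I_3) : letter :=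
  if i == 0 :> nat then letter_c else letter_d.

Lemma phi_silent i : phi i (silent i) = 1.
Proof. by case: i => -[|[|[]]]. Qed.
Lemma phi_active i : phi i (active i) = swapT.
Proof. by case: i => -[|[|[]]]. Qed.
Lemma phi_other i : phi i (other i) = swapT.
Proof. by case: i => -[|[|[]]]. Qed.

Lemma letter_cases i l : [\/ l = silent i, l = active i | l = other i].
Proof.
by case: i l => -[|[|[|//]]] ? []; do [exact: Or31|exact: Or32|exact: Or33].
Qed.

Lemma phi_eq1_inj l i j : phi i l = 1 -> phi j l = 1 -> i = j.
Proof.
have sw1 : swapT <> 1 by rewrite -pair11; exact: swap_neq_pair.
move=> il jl; apply: val_inj => /=; move: il jl.
by case: l => /=; do 2![case: eqP => [->|_ // /sw1 //]].
Qed.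

(** If a letter acts trivially then so do all its components phi (omega i), and
    each of these determines omega i. *)
Lemma lett_neq1 l omega : ~ eventually_constant omega -> lett l omega <> 1.
Proof.
move=> nc l1; apply: nc.
have phi1 i : phi (omega i) l = 1.
  elim: i omega l1 => [|i IHi] omega; rewrite lettE -{1}pair11 => /pair_inj[] //.
  by move=> _ /IHi.
by exists 0%N, (omega 0) => i _; apply: phi_eq1_inj (phi1 i) (phi1 0%N).
Qed.

Lemma shift_nconst omega : ~ eventually_constant omega ->
  ~ eventually_constant (Defs.shift omega).
Proof.
by move=> nc [N [k Nk]]; apply: nc; exists N.+1, k => -[//|i] /Nk.
Qed.

(** Words over the alphabet a, b, c, d are sequences of option letters; None
    stands for a. *)
Definition ev_word (M : groupType) (f : option letter -> M)
    (W : seq (option letter)) : M :=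
  \prod_(o <- W) f o.

Lemma ev_cat (M : groupType) (f : option letter -> M) U W :
  ev_word f (U ++ W) = ev_word f U * ev_word f W.
Proof. by rewrite /ev_word big_cat. Qed.
Lemma ev_cons (M : groupType) (f : option letter -> M) o W :
  ev_word f (o :: W) = f o * ev_word f W.
Proof. by rewrite /ev_word big_cons. Qed.
Lemma ev_nil (M : groupType) (f : option letter -> M) : ev_word f [::] = 1.
Proof. by rewrite /ev_word big_nil. Qed.

Definition std_gen omega (o : option letter) : autT :=
  if o is Some l then lett l omega else swapT.

Definition subst_letter i o : seq (option letter) :=
  if o is Some l then [:: Some l] else [:: None; Some (active i); None].
Definition subst_word i W := flatten (map (subst_letter i) W).

(** The action of a substituted word on the first subtree: a y a acts there as y
    and a letter l acts as phi (omega 0) l. *)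
Definition side_gen omega (o : option letter) : autT :=
  if o is Some l then phi (omega 0) l
  else lett (active (omega 0)) (Defs.shift omega).

Lemma ev_word_subst (M : groupType) (f : option letter -> M) i W :
  ev_word f (subst_word i W) = ev_word (fun o => ev_word f (subst_letter i o)) W.
Proof.
elim: W => [|o W IH]; first by rewrite !ev_nil.
by rewrite ev_cons -IH -ev_cat.
Qed.

Lemma ev_std_gen_subst omega W :
  ev_word (std_gen omega) (subst_word (omega 0) W) =
  pair (ev_word (side_gen omega) W) (ev_word (std_gen (Defs.shift omega)) W).
Proof.
rewrite ev_word_subst; elim: W => [|o W IH]; first by rewrite !ev_nil pair11.
rewrite !ev_cons IH -pairM; congr (_ * _); case: o => [l|].
  by rewrite ev_cons ev_nil mulg1 /= lettE.
by rewrite !ev_cons ev_nil mulg1 mulgA /= lettE phi_active swap_pair.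
Qed.

(** The commutator [[x^a, y], z^a], written out for involutions. *)
Definition base_word i : seq (option letter) :=
  let a := None in let x := Some (silent i) in
  let y := Some (active i) in let z := Some (other i) in
  [:: a; x; a; y; a; x; a; y; a; z; a; y; a; x; a; y; a; x; a; a; z; a].

(** Satisfied by the words that lie in the normal closure of b, in that of c and
    in that of d, in the free product of the groups of order 2 generated by
    a, b, c, d. *)
Definition killed_word W := forall f : option letter -> autT,
  (forall o, f o * f o = 1) -> (exists l, f (Some l) = 1) -> ev_word f W = 1.

Lemma killed_base i : killed_word (base_word i).
Proof.
move=> f f2 [l fl]; have fK g o : g * f o * f o = g.
  by rewrite -mulgA f2 mulg1.
rewrite /base_word !ev_cons ev_nil mulg1 !mulgA.
by have [E|E|E] := letter_cases i l; rewrite -E !(fl, mulg1, f2, fK).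
Qed.

(** Precomposing f with the substitution keeps involutions and fixes b, c, d. *)
Lemma killed_subst i W : killed_word W -> killed_word (subst_word i W).
Proof.
move=> tW f f2 [l fl]; have fK g o : g * f o * f o = g.
  by rewrite -mulgA f2 mulg1.
rewrite ev_word_subst; apply: tW; last by exists l; rewrite ev_cons ev_nil mulg1.
by case=> [k|]; rewrite !ev_cons ev_nil mulg1 ?mulgA ?(f2, fK).
Qed.

Lemma killed_conj o W : killed_word W -> killed_word (o :: rcons W o).
Proof.
move=> tW f f2 fl; rewrite -cats1 ev_cons ev_cat tW // mul1g.
by rewrite ev_cons ev_nil mulg1.
Qed.

Lemma side_gen2 omega o : side_gen omega o * side_gen omega o = 1.
Proof. by case: o => [l|]; [exact: phi2|exact: lett2]. Qed.

(** A word in the rigid stabiliser of u: the substitution moves an element to the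
    second subtree, and conjugation by a then moves it to the first one. *)
Fixpoint rist_word omega (u : vertex) : seq (option letter) :=
  if u is x :: w then
    let W := subst_word (omega 0) (rist_word (Defs.shift omega) w) in
    if x then W else None :: rcons W None
  else base_word (omega 0).

Lemma killed_rist omega u : killed_word (rist_word omega u).
Proof.
elim: u omega => [|x u IHu] omega /=; first exact: killed_base.
by case: x; [|apply: killed_conj]; exact: killed_subst.
Qed.

Lemma ev_rist_cons omega x u :
  ev_word (std_gen omega) (rist_word omega (x :: u)) =
  let o := Defs.shift omega in let g := ev_word (std_gen o) (rist_word o u) in
  if x then pair 1 g else pair g 1.
Proof.
have side1 : ev_word (side_gen omega) (rist_word (Defs.shift omega) u) = 1.
  apply: killed_rist; first exact: side_gen2.
  by exists (silent (omega 0)); exact: phi_silent.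
case: x => /=; first by rewrite ev_std_gen_subst side1.
rewrite -cats1 ev_cons ev_cat ev_std_gen_subst side1 ev_cons ev_nil mulg1 mulgA.
exact: swap_pair.
Qed.

Lemma ev_rist omega u u' v : size u' = size u ->
  ev_word (std_gen omega) (rist_word omega u) (u' ++ v) =
  u' ++ (if u' == u
         then ev_word (std_gen (iter (size u) Defs.shift omega))
                 (base_word (iter (size u) Defs.shift omega 0)) v
         else v).
Proof.
elim: u omega u' => [|x u IHu] omega [|x' u'] //= [uu'].
rewrite ev_rist_cons eqseq_cons.
by case: x; case: x'; rewrite /= ?IHu // -iterSr.
Qed.

Lemma phi_cases i l : phi i l = 1 \/ phi i l = swapT.
Proof. by case: l => /=; case: ifP; [left|right|left|right|left|right]. Qed.

Lemma phi_silent_other i j :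
  phi i (silent j) = swapT \/ phi i (other j) = swapT.
Proof.
by case: i => -[|[|[]]] // ?; case: j => -[|[|[]]] // ?; first [by left|by right].
Qed.

Lemma comm_swap_neq1 l omega : ~ eventually_constant omega ->
  lett l omega * swapT * lett l omega * swapT <> 1.
Proof.
move=> nc; rewrite -!mulgA (mulgA swapT) lettE swap_pair.
rewrite pairM -pair11 => /pair_inj[_].
have [->|->] := phi_cases (omega 0) l.
  by rewrite mulg1; apply: lett_neq1; exact: shift_nconst.
by move/(congr1 (fun g : autT => g [:: false])).
Qed.

(** Equivalently, a k a and l k l differ.  On the second subtree they act as
    phi (omega 0) k and as a conjugate of the letter k: if the former is 1 the
    latter is not, and if it is a, only the former swaps the first level. *)
Lemma conj_swap_neq1 l k omega : ~ eventually_constant omega ->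
  lett l omega * swapT * lett k omega * swapT * lett l omega * lett k omega
    <> 1.
Proof.
move=> nc; rewrite -!mulgA (mulgA swapT _ (swapT * _)) (mulgA (swapT * _) swapT).
rewrite (lettE l) (lettE k) swap_pair !pairM -pair11 => /pair_inj[_].
rewrite !mulgA.
have [->|->] := phi_cases (omega 0) k.
  rewrite mulg1 lett2 mul1g; apply: lett_neq1; exact: shift_nconst.
by move/(congr1 (fun g : autT => g [:: false])).
Qed.

(** Two levels down, the commutator has the two components
    p x q x p q and x p z p x z, where p and q are the values of phi on x and z.
    If p = a, the second component is nontrivial by conj_swap_neq1.  If p = 1,
    then q = a, and the first component is nontrivial by comm_swap_neq1. *)
Lemma base_word_neq1 omega : ~ eventually_constant omega ->
  ev_word (std_gen omega) (base_word (omega 0)) <> 1.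
Proof.
move=> nc; set x := silent (omega 0); set y := active (omega 0).
set z := other (omega 0); set w1 := Defs.shift omega; set w2 := Defs.shift w1.
have nc2 : ~ eventually_constant w2 by do 2!apply: shift_nconst.
have -> : ev_word (std_gen omega) (base_word (omega 0)) =
    pair (lett x w1 * (swapT * lett x w1 * swapT) * lett z w1 *
          (swapT * lett x w1 * swapT * lett x w1) * lett z w1) 1.
  pose A l := swapT * lett l omega * swapT.
  have -> : ev_word (std_gen omega) (base_word (omega 0)) =
    A x * lett y omega * A x * lett y omega * A z *
    lett y omega * A x * lett y omega * A x * A z.
    by rewrite /base_word !ev_cons ev_nil mulg1 /A !mulgA.
  rewrite /A !(lettE _ omega) phi_silent phi_active phi_other !swap_pair !pairM.
  by rewrite !mulg1 !mul1g ?mulgA lett2 mul1g -(mulgA swapT) lett2 mulg1 swapT2.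
rewrite -pair11 => /pair_inj[+ _].
have -> : lett x w1 * (swapT * lett x w1 * swapT) * lett z w1 *
      (swapT * lett x w1 * swapT * lett x w1) * lett z w1 =
    let p := phi (w1 0) x in let q := phi (w1 0) z in
    let x2 := lett x w2 in let z2 := lett z w2 in
    pair (p * x2 * q * x2 * p * q) (x2 * p * z2 * p * x2 * z2).
  by rewrite !(lettE _ w1) swap_pair !pairM !mulgA.
rewrite -pair11 => /pair_inj[].
have [->|->] := phi_silent_other (w1 0) (omega 0).
  by move=> _; exact: conj_swap_neq1.
have [->|->] := phi_cases (w1 0) x.
  rewrite mul1g mulg1 => + _; exact: comm_swap_neq1.
by move=> _; exact: conj_swap_neq1.
Qed.


(** The substitution doubles the number of letters a, and adds the old number of
    letters a to the number of other letters. *)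
Definition count_a (W : seq (option letter)) := count (fun o => ~~ isSome o) W.
Definition count_l (W : seq (option letter)) := count isSome W.

Lemma count_a_subst i W : count_a (subst_word i W) = (2 * count_a W)%N.
Proof.
elim: W => //= -[l|] W IH; rewrite /subst_word /count_a /= ?IH in IH *; lia.
Qed.

Lemma count_l_subst i W : count_l (subst_word i W) = (count_a W + count_l W)%N.
Proof.
elim: W => //= -[l|] W IH; rewrite /subst_word /count_a /count_l /= ?IH in IH *; lia.
Qed.

Lemma size_rist omega u : (size (rist_word omega u) <= 28 * 2 ^ size u)%N.
Proof.
have -> W : size W = (count_a W + count_l W)%N.
  by rewrite addnC -(count_predC isSome).
(* The summand 2 absorbs the conjugation by a: 2 c + 2 + 2 = 2 (c + 2). *)
suff: (count_a (rist_word omega u) + 2 <= 14 * 2 ^ size u /\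
   count_l (rist_word omega u) <= 14 * 2 ^ size u)%N by lia.
elim: u omega => [|x u IHu] omega //.
have [] := IHu (Defs.shift omega).
have ca W : count_a (None :: rcons W None) = (count_a W + 2)%N.
  by rewrite /count_a -cats1 /= count_cat /= addnC -addnA.
have cl W : count_l (None :: rcons W None) = count_l W.
  by rewrite /count_l -cats1 /= count_cat addn0.
rewrite /= expnS; case: x; rewrite ?(ca, cl) count_a_subst count_l_subst; lia.
Qed.

End Eval.

(** * Exponential lower bound *)

Definition grig_std omega (o : option letter) : grigorchuk omega :=
  match o with
  | None => grig_a omega
  | Some letter_b => grig_b omega
  | Some letter_c => grig_c omega
  | Some letter_d => grig_d omega
  end.

Lemma grig_std_in omega o : grig_std omega o \in grig_S omega.
Proof.
rewrite !in_fsetE; case: o => [[]|] /=.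
- by rewrite (eqxx (grig_b omega)) ?orbT.
- by rewrite (eqxx (grig_c omega)) ?orbT.
- by rewrite (eqxx (grig_d omega)) ?orbT.
- by rewrite (eqxx (grig_a omega)).
Qed.

Lemma val_grig_ev omega W :
  val (ev_word (grig_std omega) W) = ev_word (std_gen omega) W.
Proof.
elim: W => [|o W IHW]; first by rewrite !ev_nil.
by rewrite !ev_cons -IHW; case: o => [[]|].
Qed.

Lemma grig_a_neq1 omega : grig_a omega != 1%g.
Proof.
apply/eqP => /(congr1 (fun g : grigorchuk omega => gen_val g)).
by move/(congr1 (fun g : autT => g [:: false])).
Qed.

(** Each of the 2^m directions costs at most 28 * 2^m letters, which is at most
    n/2; and 4 * 2^(m - 3) < 2^m. *)
Lemma grig_folner_card (R : realType) omega m n (V : {fset grigorchuk omega}) :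
    ~ eventually_constant omega -> (3 <= m)%N -> (56 * 2 ^ m <= n)%N ->
    V != fset0 -> (n * #|` boundary R (grig_S omega) V| <= #|` V|)%N ->
  (2 ^ (2 ^ (m - 3)) <= #|` V|)%N.
Proof.
move=> nc m3 mn V0 bV; set om := iter m Defs.shift omega.
have ncm : ~ eventually_constant om.
  by rewrite /om; elim: (m) => //= k; exact: shift_nconst.
have [y ymoved] : exists y, ev_word (std_gen om) (base_word (om 0)) y <> y.
  apply: contrapT => fixed; apply: (base_word_neq1 ncm); apply: autT_eq => y.
  by apply: contrapT => my; apply: fixed; exists y.
pose t (u : m.-tuple bool) := [seq grig_std omega o | o <- rist_word omega u].
pose p (u : m.-tuple bool) (g : grigorchuk omega) := val g (u ++ y).
have tE u g v : val (g * \prod_(x <- t u) x)%g v =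
    val g (ev_word (std_gen omega) (rist_word omega u) v).
  by rewrite -val_grig_ev /ev_word big_map.
have p_neq u g : p u (g * \prod_(x <- t u) x)%g != p u g.
  rewrite /p tE ev_rist // eqxx size_tuple.
  have [/bij_inj g_inj _ _] := autTP (val g).
  by rewrite (inj_eq g_inj) eqseq_cat // eqxx; exact/eqP.
have p_eq u u' g : u' != u -> p u' (g * \prod_(x <- t u) x)%g = p u' g.
  rewrite -val_eqE /= => /negPf uu'.
  by rewrite /p tE ev_rist ?size_tuple // uu'.
apply: (folner_card_cube (R := R) (S := grig_S omega) (t := t) _ p_neq p_eq
  (L := 28 * 2 ^ m)) => //.
- by move=> u; rewrite /t; elim: (rist_word _ _) => //= ? ? ->; rewrite grig_std_in.
- move=> u; rewrite size_map; apply: leq_trans (size_rist _ _) _.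
  by rewrite size_tuple.
- by apply: leq_trans bV; rewrite leq_mul2r mulnA mn orbT.
- rewrite card_tuple card_bool -[X in (_ < 2 ^ X)%N](subnK m3) expnD.
  by rewrite [ltnRHS]mulnC ltn_pmul2r // expn_gt0.
Qed.

(** Take the largest m with 56 * 2^m <= n, so that n < 112 * 2^m, which is
    896 * 2^(m - 3).  The condition 3 <= m holds from n = 448 = 56 * 8 on; below
    that, two points are enough. *)
Lemma grig_folner_exp (R : realType) : exists2 K, (0 < K)%N &
  forall omega, ~ eventually_constant omega ->
  forall n (V : {fset grigorchuk omega}), (2 <= n)%N -> V != fset0 ->
    (n * #|` boundary R (grig_S omega) V| <= #|` V|)%N ->
  exists2 d, (n <= K * d)%N & (2 ^ d <= #|` V|)%N.
Proof.
exists 896 => // omega nc n V n2 V0 bV.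
have [n_small|n_big] := ltnP n 448.
  exists 1%N; first by rewrite muln1; lia.
  apply: (@folner_card_gt1 R) (grig_std_in omega None) (grig_a_neq1 omega) V0 _.
  by apply: leq_trans _ bV; rewrite leq_mul2r n2 orbT.
have q8 : (8 <= n %/ 56)%N by rewrite leq_divRL.
have q0 : (0 < n %/ 56)%N by exact: leq_trans q8.
set m := trunc_log 2 (n %/ 56).
have m3 : (3 <= m)%N by apply: trunc_log_max.
have mn : (56 * 2 ^ m <= n)%N by rewrite mulnC -leq_divRL // trunc_logP.
exists (2 ^ (m - 3))%N; last exact: grig_folner_card mn V0 bV.
have : (n %/ 56 < 2 ^ m.+1)%N by exact: trunc_log_ltn.
rewrite ltn_divLR // -{1}(subnK m3) -addnS expnD => /ltnW.
by rewrite -mulnA mulnC.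
Qed.

Theorem mainTheorem3 (R : realType) :
  exists C : R, 0 < C /\
    forall omega : nat -> 'I_3, ~ eventually_constant omega ->
    forall n : nat, (2 <= n)%N ->
      ((2 `^ (C * n%:R))%:E <= folner R (grig_S omega) n)%E.
Proof.
have [K K0 grigK] := grig_folner_exp R.
exists K%:R^-1; split=> [|omega nc n n2]; first by rewrite invr_gt0 ltr0n.
apply/ereal_infP => _ [V [V0 bV] <-]; rewrite lee_fin.
have [||d nd dV] := grigK _ nc n V n2 => //.
  move: bV; rewrite ler_pdivrMr ?ltr0n ?cardfs_gt0 // mulrC ler_pdivlMr.
    by rewrite -natrM ler_nat mulnC.
  by rewrite ltr0n; exact: ltnW.
apply: (@le_trans _ _ (2 `^ d%:R)).
  by rewrite ler_powR ?ler1n // mulrC ler_pdivrMr ?ltr0n // -natrM ler_nat mulnC.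
by rewrite powR_mulrn // -natrX ler_nat.
Qed.
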